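(* Let $k,t$ be integers with $k\geq 5$ and $k=t$. Then $$\operatorname{gr}_k(P_5:K_t)=(t-1)^2+1 .$$
   Context: All graphs are finite, simple and undirected. $K_n$ is the complete graph on $n$ vertices and $P_5$ is the path with $5$ vertices and $4$ edges. A $k$-edge-coloring assigns to each edge one of $k$ colors; all $k$-edge-colorings are assumed exact, i.e. each of the $k$ colors is used at least once. An edge-colored graph is rainbow if all its edges have different colors and monochromatic if all its edges have a single color. A copy of a graph means a (not necessarily induced) subgraph isomorphic to it. For non-empty graphs $G,H$ (graphs with at least one edge) and a positive integer $k$, the Gallai-Ramsey number $\operatorname{gr}_k(G:H)$ is the minimum integer $N$ with $\binom{N}{2}\geq k$ (so that $K_N$ admits a $k$-edge-coloring) such that for all $n\geq N$, every $k$-edge-coloring of $K_n$ contains either a rainbow copy of $G$ or a monochromatic copy of $H$. *)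

(* Defs.v *)
From mathcomp Require Import all_boot.

Set Implicit Arguments.
Unset Strict Implicit.
Unset Printing Implicit Defensive.

Record sgraph := SGraph {
  vertex :> finType;
  adj : rel vertex;
  adj_sym : symmetric adj;
  adj_irr : irreflexive adj }.

Arguments adj : clear implicits.

Definition edges (G : sgraph) : {set {set G}} :=
  [set e : {set G} | [exists x, exists y, adj G x y && (e == [set x; y])]].

Definition complete_rel (n : nat) : rel 'I_n := fun x y => x != y.

Lemma complete_rel_sym n : symmetric (@complete_rel n).
Proof. by move=> x y; rewrite /complete_rel eq_sym. Qed.

Lemma complete_rel_irr n : irreflexive (@complete_rel n).
Proof. by move=> x; rewrite /complete_rel eqxx. Qed.

Definition complete_graph (n : nat) : sgraph :=
  SGraph (@complete_rel_sym n) (@complete_rel_irr n).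

Definition path_rel (n : nat) : rel 'I_n :=
  fun x y => (x.+1 == y :> nat) || (y.+1 == x :> nat).

Lemma path_rel_sym n : symmetric (@path_rel n).
Proof. by move=> x y; rewrite /path_rel orbC. Qed.

Lemma path_rel_irr n : irreflexive (@path_rel n).
Proof. by move=> x; rewrite /path_rel orbb (gtn_eqF (ltnSn x)). Qed.

(* The parameter counts vertices, so path_graph n has n - 1 edges. *)
Definition path_graph (n : nat) : sgraph :=
  SGraph (@path_rel_sym n) (@path_rel_irr n).

(* A k-edge-coloring of A is represented by a function on all vertex sets of A.
   Only its values on edges A are ever used. *)
Definition coloring (A : sgraph) (k : nat) := {set A} -> 'I_k.

Definition exact_coloring (A : sgraph) (k : nat) (c : coloring A k) : Prop :=
  forall i : 'I_k, exists2 e, e \in edges A & c e = i.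

Definition rainbow (A : sgraph) (k : nat) (c : coloring A k)
  (E : {set {set A}}) : Prop := {in E &, injective c}.

Definition monochromatic (A : sgraph) (k : nat) (c : coloring A k)
  (E : {set {set A}}) : Prop := exists i : 'I_k, forall e, e \in E -> c e = i.

(* The subgraphs of A isomorphic to G are the images of the injective
   edge-preserving maps G -> A; they need not be induced. *)
Definition embedding (G A : sgraph) (f : G -> A) : Prop :=
  injective f /\ (forall x y, adj G x y -> adj A (f x) (f y)).

Definition image_edges (G A : sgraph) (f : G -> A) : {set {set A}} :=
  [set f @: (e : {set G}) | e in edges G].

Definition has_rainbow_copy (G A : sgraph) (k : nat) (c : coloring A k) : Prop :=
  exists f : G -> A, embedding f /\ rainbow c (image_edges f).

Definition has_monochromatic_copy (H A : sgraph) (k : nat) (c : coloring A k)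
  : Prop :=
  exists f : H -> A, embedding f /\ monochromatic c (image_edges f).

Definition gallai_ramsey_bound (k : nat) (G H : sgraph) (N : nat) : Prop :=
  k <= 'C(N, 2) /\
  forall n, N <= n -> forall c : coloring (complete_graph n) k,
      exact_coloring c ->
    has_rainbow_copy G c \/ has_monochromatic_copy H c.

(* "gr_k(G : H) = N", as a relation, so that asserting it includes the
   existence of the minimum. *)
Definition is_gallai_ramsey (k : nat) (G H : sgraph) (N : nat) : Prop :=
  gallai_ramsey_bound k G H N /\
  forall M, gallai_ramsey_bound k G H M -> N <= M.

(* Main.v *)
Require Import Defs.
From mathcomp Require Import all_boot.
From mathcomp Require Import zify.

(* In a coloring of a complete graph with at least five colors and no rainbow
   P_5, either deleting some vertex leaves a monochromatic graph, or some color d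
   is dominant: every vertex sees at most one color besides d. Indeed, a vertex
   seeing three colors forces the former; if there is none, the sets of colors seen
   at the vertices have size at most 2, pairwise intersect and have more than three
   elements in total, so they share a color d. The first case
   contains K_k at once. In the second case, label each vertex by the non-dominant
   color it sees; edges between different labels have color d. If some vertex
   sees only d, one vertex per label gives a K_k of color d. Otherwise only k - 1
   labels occur, so a label j has at least k vertices, and either these span a K_k
   of color j or they contain an edge of color d, which together with one vertex
   from each other label spans a K_k of color d. For the lower bound, split
   (k - 1)^2 vertices into k - 1 blocks of size k - 1, give each block its own
   color and all remaining edges the last color. *)

Set Implicit Arguments.
Unset Strict Implicit.
Unset Printing Implicit Defensive.

(** * Local structure of colorings without a rainbow path on five vertices *)

Section NoRainbowPath.

Variables (V : finType) (K : eqType) (C : V -> V -> K).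

Definition distinct5 (T : Type) (a b c d e : T) : Prop :=
  (a <> b /\ a <> c /\ a <> d /\ a <> e) /\
  (b <> c /\ b <> d /\ b <> e) /\ (c <> d /\ c <> e) /\ d <> e.

Definition no_rainbow_path5 : Prop := forall a b c d e : V,
  distinct5 a b c d e ->
  C a b = C b c \/ C a b = C c d \/ C a b = C d e \/
  C b c = C c d \/ C b c = C d e \/ C c d = C d e.

Definition monochromatic_off (v : V) : Prop :=
  exists e, forall a b, a <> v -> b <> v -> a <> b -> C a b = e.

Hypothesis Csym : forall x y, C x y = C y x.
Hypothesis noP5 : no_rainbow_path5.

(* [path5 a b c d e] leaves the color coincidences along the path a b c d e that
   are not refuted by the colors already known. *)
Ltac path5 a b c d e :=
  have := Csym a b; have := Csym b c; have := Csym c d; have := Csym d e;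
  unfold distinct5 in *; intros; repeat match goal with H : _ /\ _ |- _ => destruct H end;
  destruct (@noP5 a b c d e) as [?|[?|[?|[?|[?|?]]]]];
  [repeat split; congruence | | | | | |];
  try first [congruence | left; congruence | right; congruence].

(** The star at [v] and the edge [y z] carry five colors, so paths through them leave few colors for
    a further edge. For [C x z] the value [C v y] survives until the path [z x v w y] excludes
    it. *)
Lemma star4_edge v x w y z :
  distinct5 v x w y z -> distinct5 (C v x) (C v w) (C v y) (C v z) (C y z) ->
  C x w = C y z /\ C x z = C y z.
Proof.
move=> dv dc.
have ? : C x w = C y z by path5 w x v y z; path5 w x v z y; path5 x w v y z.
have xz : C x z = C v y \/ C x z = C y z by path5 x z y v w; path5 w x z v y.
have wy : C w y = C v z \/ C w y = C y z by path5 w y z v x; path5 x w y v z.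
split=> //; case: xz => //; case: wy => ? ?; path5 z x v w y.
Qed.

(** The hypotheses allow exchanging [x] with [w] and [y] with [z], so [star4_edge] settles all six
    edges among these vertices. The color then spreads to edges with one end outside, and finally to
    edges with both ends outside. *)
Lemma star4_monochromatic_off v x w y z :
  distinct5 v x w y z -> distinct5 (C v x) (C v w) (C v y) (C v z) (C y z) ->
  monochromatic_off v.
Proof.
move=> dv dc; exists (C y z).
have [xw xz] := @star4_edge v x w y z dv dc.
have [wx wz] : C w x = C y z /\ C w z = C y z.
  by apply: (@star4_edge v); move: dv dc; rewrite /distinct5; intuition congruence.
have [_ xy] : C x w = C z y /\ C x y = C z y.
  apply: (@star4_edge v); rewrite ?(Csym z y); move: dv dc; rewrite /distinct5;
    intuition congruence.
have [_ wy] : C w x = C z y /\ C w y = C z y.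
  apply: (@star4_edge v); rewrite ?(Csym z y); move: dv dc; rewrite /distinct5;
    intuition congruence.
rewrite (Csym z y) in xy wy; move: dv dc; move=> dv dc.
have off_v u : u <> v -> [/\ u <> x -> C u x = C y z, u <> w -> C u w = C y z,
    u <> y -> C u y = C y z & u <> z -> C u z = C y z].
  move=> uv.
  have [->|/eqP ?] := eqVneq u x; first by split; congruence.
  have [->|/eqP ?] := eqVneq u w; first by split; congruence.
  have [->|/eqP ?] := eqVneq u y.
    by split; rewrite ?(Csym y x) ?(Csym y w); congruence.
  have [->|/eqP ?] := eqVneq u z.
    by split; rewrite ?(Csym z x) ?(Csym z w) ?(Csym z y); congruence.
  have ux : C u x = C y z by path5 u x v y z; path5 u x v z y; path5 u x w v y.
  have uw : C u w = C y z by path5 u w v y z; path5 u w v z y; path5 u w x v y.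
  have uz : C u z = C y z.
    by path5 u z y v x; path5 u z y v w; path5 u z v w x.
  have uy : C u y = C y z.
    by path5 u y z v x; path5 u y z v w; path5 u y v w x.
  by [].
move=> a b av bv ab.
have [? ? ? ?] := off_v a av; have [? ? ? ?] := off_v b bv.
have [?|/eqP ?] := eqVneq b x; first by subst; auto.
have [?|/eqP ?] := eqVneq b w; first by subst; auto.
have [?|/eqP ?] := eqVneq b y; first by subst; auto.
have [?|/eqP ?] := eqVneq b z; first by subst; auto.
have [?|/eqP ?] := eqVneq a x; first by subst; rewrite Csym; auto.
have [?|/eqP ?] := eqVneq a w; first by subst; rewrite Csym; auto.
have [?|/eqP ?] := eqVneq a y; first by subst; rewrite Csym; auto.
have [?|/eqP ?] := eqVneq a z; first by subst; rewrite Csym; auto.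
have [bx bw] : C b x = C y z /\ C b w = C y z by auto.
by path5 a b x v y; path5 a b x v w; path5 a b w v y.
Qed.

Hypothesis five_vertices : forall a b c d : V,
  exists w, w <> a /\ w <> b /\ w <> c /\ w <> d.
Hypothesis five_colors : forall p q r s : K,
  exists a b, a <> b /\ C a b <> p /\ C a b <> q /\ C a b <> r /\ C a b <> s.

Definition missing (v : V) (e : K) : Prop := forall u, u <> v -> C v u <> e.

(** This form directly supplies a neighbor whose color avoids two given ones. *)
Definition three_colors_at (v : V) : Prop := forall p q,
  exists x, x <> v /\ C v x <> p /\ C v x <> q.

Lemma missingVex v e : missing v e \/ exists2 u, u <> v & C v u = e.
Proof.
have [/existsP[u /andP[/eqP uv /eqP ue]]|/existsPn H] :=
  boolP [exists u, (u != v) && (C v u == e)]; [by right; exists u|left].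
by move=> u uv ue; move: (H u); rewrite ue eqxx andbT => /negPn/eqP.
Qed.

Lemma missing_off v a b : a <> b -> missing v (C a b) -> a <> v /\ b <> v.
Proof.
move=> ab m; split=> ?; subst v; first by apply: (m b); [exact: nesym|].
by apply: (m a ab); rewrite Csym.
Qed.

(** If the colors of [v y] and [v z] differed, a third color at [v] would force [C v x] to differ
    from both. Then no color remains for the edge from [z] to a fifth vertex. *)
Lemma two_missing_adjacent v x y z :
  three_colors_at v -> x <> v -> y <> v -> z <> v -> x <> y -> y <> z -> x <> z ->
  missing v (C x y) -> missing v (C y z) -> C x y <> C y z ->
  C v y = C v z.
Proof.
move=> v3 xv yv zv xy yz xz mxy myz neq.
have [//|/eqP neq'] := eqVneq (C v y) (C v z); exfalso.
have := mxy x xv; have := mxy y yv; have := mxy z zv.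
have := myz x xv; have := myz y yv; have := myz z zv; intros.
have x_eq w : w <> v -> w <> x -> w <> y -> w <> z -> C v w = C v x.
  move=> ? ? ? ?; have ? := mxy w; have ? := myz w.
  have := mxy w; have := myz w; intuition.
  by path5 w v x y z.
have [a [av [? ?]]] := v3 (C v y) (C v z).
have ? : C v x <> C v y /\ C v x <> C v z.
  have [<-//|/eqP ax] := eqVneq a x.
  by rewrite -(x_eq a) //; congruence.
have [w [? [? [? ?]]]] := five_vertices v x y z.
by path5 x v y z w; path5 v x y z w; path5 x y v z w.
Qed.

(** Take an edge [a b] of a fifth color. If [v] sees this color, [star4_monochromatic_off] applies.
    Otherwise paths through [v] force every edge of this color to meet [y] or [z], which
    [two_missing_adjacent] forbids. *)
Lemma missing_scalene_monochromatic_off v y z :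
  three_colors_at v -> y <> v -> z <> v -> y <> z ->
  missing v (C y z) -> C v y <> C v z -> monochromatic_off v.
Proof.
move=> v3 yv zv yz myz neq.
have [x [xv [xy xz]]] := v3 (C v y) (C v z).
have [a [b [ab [sp [sq [sr se]]]]]] := five_colors (C v y) (C v z) (C v x) (C y z).
have := myz x xv; have := myz y yv; have := myz z zv; intros.
have [ms|[w wv ws]] := missingVex v (C a b); last first.
  by apply: (@star4_monochromatic_off v x w y z); repeat split; congruence.
exfalso; have [av bv] := missing_off ab ms.
have avoid c d : c <> v -> d <> v -> c <> d -> C c d = C a b ->
    c <> y -> c <> z -> d = y \/ d = z.
  move=> cv dv cd cE cy cz.
  have [?|/eqP ?] := eqVneq d y; first by left.
  have [?|/eqP ?] := eqVneq d z; first by right.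
  have := ms c cv; have := myz c cv; intros.
  by path5 d c v y z; path5 d c v z y.
have adj c d : c <> v -> d <> v -> c <> d -> C c d = C a b -> ~ (c = y \/ c = z).
  move=> cv dv cd cE [cy|cz]; subst c; apply: neq.
    have ? : d <> z by congruence.
    by apply: (@two_missing_adjacent v d y z) => //; try congruence; rewrite Csym cE.
  have := Csym z y => zy; have ? : d <> y by congruence.
  symmetry; apply: (@two_missing_adjacent v d z y) => //; try congruence.
  - by rewrite Csym cE.
  - by rewrite zy.
have ay : ~ (a = y \/ a = z) by apply: (adj a b).
have bz : b = y \/ b = z by apply: (avoid a b) => //; intuition.
by apply: (adj b a) bz => //; apply: nesym.
Qed.

(** Two paths leave only [C v x1] and [C y z] for [C y x2]; the latter makes the triangle [v y x2]
    scalene with a missing color. *)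
Lemma missing_isosceles v y z x1 x2 :
  three_colors_at v -> y <> v -> z <> v -> y <> z -> x1 <> v -> x2 <> v ->
  missing v (C y z) -> C v y = C v z -> C v x1 <> C v y -> C v x2 <> C v y ->
  C v x1 <> C v x2 -> C y x2 = C v x1 \/ monochromatic_off v.
Proof.
move=> v3 yv zv yz x1v x2v myz eq n1 n2 n12.
have := myz x1 x1v; have := myz x2 x2v; have := myz y yv; intros.
have [E|E] : C y x2 = C v x1 \/ C y x2 = C y z by path5 x1 v x2 y z; path5 x2 y z v x1.
  by left.
right; apply: (@missing_scalene_monochromatic_off v y x2) => //; try congruence.
by rewrite E.
Qed.

Lemma missing_monochromatic_off v y z :
  three_colors_at v -> y <> v -> z <> v -> y <> z ->
  missing v (C y z) -> monochromatic_off v.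
Proof.
move=> v3 yv zv yz myz.
have [eq|/eqP neq] := eqVneq (C v y) (C v z); last first.
  exact: (@missing_scalene_monochromatic_off v y z).
have [x1 [x1v [n1 _]]] := v3 (C v y) (C v y).
have [x2 [x2v [n2 n12]]] := v3 (C v y) (C v x1).
have [a [b [ab [sp [s1 [s2 se]]]]]] := five_colors (C v y) (C v x1) (C v x2) (C y z).
(* If [v] sees the fifth color at [x3], then [missing_isosceles] would give [C y x2] the two
   different values [C v x1] and [C v x3]. *)
have [ms|[x3 x3v s3]] := missingVex v (C a b); last first.
  have [E1|//] : C y x2 = C v x1 \/ monochromatic_off v.
    by apply: (@missing_isosceles v y z) => //; congruence.
  have [E2|//] : C y x2 = C v x3 \/ monochromatic_off v.
    by apply: (@missing_isosceles v y z) => //; congruence.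
  by exfalso; congruence.
have [av bv] := missing_off ab ms.
have [ab_eq|/eqP ab_neq] := eqVneq (C v a) (C v b); last first.
  exact: (@missing_scalene_monochromatic_off v a b).
have := ms a av; have := myz a av; have := ms y yv; have := myz y yv.
have := ms x1 x1v; have := myz x1 x1v; have := ms x2 x2v; have := myz x2 x2v.
(* Both [y z] and [a b] now form isosceles triangles with [v]. If their legs have the same color,
   the two edges are disjoint, [y a] has the color of the legs, and [z y a b x1] is rainbow. *)
intros; have [eq'|/eqP neq'] := eqVneq (C v a) (C v y).
  have [bx|//] : C b x1 = C v x2 \/ monochromatic_off v.
    apply: (@missing_isosceles v b a) => //; try congruence.
    by rewrite Csym.
  have arm c d u : c <> v -> d <> v -> u <> v -> c <> d -> u <> c -> u <> d ->
      C v c = C v y -> C v d = C v y -> C v u = C v y ->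
      C c d <> C v x1 -> C c d <> C v x2 -> C c d <> C v y ->
      C c u = C v y \/ C c u = C c d.
    by intros; path5 x1 v d c u; path5 x2 v d c u.
  exfalso; have := Csym a b; have := Csym y z; intros.
  have [ay|/eqP ay] := eqVneq a y.
    by subst a; destruct (arm y z b); congruence.
  have [az|/eqP az] := eqVneq a z.
    by subst a; destruct (arm z y b); congruence.
  have [by_|/eqP by_] := eqVneq b y.
    by subst b; destruct (arm y z a); congruence.
  have [bz|/eqP bz] := eqVneq b z.
    by subst b; destruct (arm z y a); congruence.
  have ya : C y a = C v y.
    have := Csym a y.
    by destruct (arm y z a); try congruence; destruct (arm a b y); congruence.
  by path5 z y a b x1.
(* With legs of different colors, a third color [C v x] is forced on [y a], and [b a y z v] is
   rainbow. *)
have [x [xv [xp xa]]] := v3 (C v y) (C v a).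
have := ms x xv; have := myz x xv; intros.
have [ya|//] : C y a = C v x \/ monochromatic_off v.
  by apply: (@missing_isosceles v y z) => //; congruence.
by exfalso; path5 b a y z v.
Qed.


Lemma three_colors_monochromatic_off v :
  three_colors_at v -> monochromatic_off v.
Proof.
move=> v3.
have [/existsP[y /existsP[z /and4P[/eqP yv /eqP zv /eqP yz /forallP m]]]|none] :=
  boolP [exists y, exists z, [&& y != v, z != v, y != z &
    [forall u, (u != v) ==> (C v u != C y z)]]].
  apply: (@missing_monochromatic_off v y z) => // u /eqP uv.
  by apply/eqP; move: (m u); rewrite uv.
have seen y z : y <> z -> exists2 u, u <> v & C v u = C y z.
  move=> yz; have [?|/eqP yv] := eqVneq y v; first by subst y; exists z; congruence.
  have [?|/eqP zv] := eqVneq z v; first by subst z; exists y.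
  have [m|//] := missingVex v (C y z); case/existsP: none; exists y.
  apply/existsP; exists z; apply/and4P; split; try exact/eqP.
  by apply/forallP => u; apply/implyP => /eqP /m /eqP.
(* Every color occurs at [v], so [v] sees at least five colors. *)
have pick p q r s : exists x,
    [/\ x <> v, C v x <> p, C v x <> q, C v x <> r & C v x <> s].
  have [a [b [ab [? [? [? ?]]]]]] := five_colors p q r s.
  by have [u uv ue] := seen a b ab; exists u; split; congruence.
(* A rainbow triangle at [v] extends by two more colors at [v] to the configuration of
   [star4_monochromatic_off]. *)
have [mono|/existsPn no_star] := boolP [exists y, exists z,
  [&& y != v, z != v, y != z, C v y != C v z, C y z != C v y & C y z != C v z]].
  have /existsP[y /existsP[z /and5P[/eqP ? /eqP ? /eqP ? /eqP ?]]] := mono.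
  move=> /andP[/eqP ? /eqP ?].
  have [x [? ? ? ? _]] := pick (C v y) (C v z) (C y z) (C y z).
  have [w [? ? ? ? ?]] := pick (C v y) (C v z) (C y z) (C v x).
  by apply: (@star4_monochromatic_off v x w y z); repeat split; congruence.
have scalene y z : y <> v -> z <> v -> C v y <> C v z ->
    C y z = C v y \/ C y z = C v z.
  move=> yv zv neq; have yz : y <> z by congruence.
  move: (no_star y) => /existsPn/(_ z); do 4![case: eqP => //= _].
  by case: eqP => [|_]; auto; case: eqP; auto.
(* An edge joining neighbors of v of different colors repeats one of these
   colors; two disjoint such edges can be linked through v at the ends whose
   colors are not repeated. *)
exfalso.
have [a [? _ _ _ _]] := pick (C v v) (C v v) (C v v) (C v v).
have [b [? ? _ _ _]] := pick (C v a) (C v v) (C v v) (C v v).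
have [c [? ? ? _ _]] := pick (C v a) (C v b) (C v v) (C v v).
have [d [? ? ? ? _]] := pick (C v a) (C v b) (C v c) (C v v).
have [||| |] := scalene a b; try congruence; move=> ?;
have [||| |] := scalene c d; try congruence; move=> ?.
- by path5 a b v d c.
- by path5 a b v c d.
- by path5 b a v d c.
- by path5 b a v c d.
Qed.

(** * Dominant colors when no vertex sees three colors *)

Definition dominant (d : K) : Prop := forall x y z,
  y <> x -> z <> x -> C x y = d \/ C x z = d \/ C x y = C x z.

Lemma dominantVex d : dominant d \/ exists x y z,
  [/\ y <> x, z <> x, C x y <> d, C x z <> d & C x y <> C x z].
Proof.
have [/existsP[x /existsP[y /existsP[z /and5P[? ? ? ? ?]]]]|none] :=
  boolP [exists x, exists y, exists z,
    [&& y != x, z != x, C x y != d, C x z != d & C x y != C x z]].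
  by right; exists x, y, z; split; apply/eqP.
left=> x y z /eqP yx /eqP zx; move/existsPn: none => /(_ x)/existsPn/(_ y).
move=> /existsPn/(_ z); rewrite yx zx /=.
by case: eqP => [|_]; [left|case: eqP => [|_]; [right; left|case: eqP]]; auto.
Qed.

(** If neither [C v a] nor [C v b] is dominant, the witnesses [x] and [y] form with [v] a rainbow
    triangle, whose vertices see only its colors. An end [u] of an edge of a fourth color lies off
    the triangle and sees at least two of the triangle colors, hence three colors in all. *)
Lemma two_colors_dominant (d0 : K) :
  (forall v a b c, a <> v -> b <> v -> c <> v ->
     C v a = C v b \/ C v a = C v c \/ C v b = C v c) ->
  exists d, dominant d.
Proof.
move=> two.
have [|[v [a [b [av bv _ _ ab]]]]] := dominantVex d0; first by exists d0.
have [|[x [x1 [x2 [x1x x2x ? ? ?]]]]] := dominantVex (C v a); first by exists (C v a).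
have [|[y [y1 [y2 [y1y y2y ? ? ?]]]]] := dominantVex (C v b); first by exists (C v b).
exfalso.
have two' u p q r : p <> u -> q <> u -> r <> u -> C u p <> C u q ->
    C u r = C u p \/ C u r = C u q.
  by move=> pu qu ru; case: (two u p q r pu qu ru) => [|[]]; auto.
have xv : v <> x.
  by move=> ?; subst x; case: (two' v a b x1); case: (two' v a b x2); congruence.
have yv : v <> y.
  by move=> ?; subst y; case: (two' v a b y1); case: (two' v a b y2); congruence.
have vx : C v x = C v b.
  have := Csym x v.
  by case: (two' v a b x); case: (two' x x1 x2 v); congruence.
have vy : C v y = C v a.
  have := Csym y v.
  by case: (two' v a b y); case: (two' y y1 y2 v); congruence.
have xy : x <> y by congruence.
have := Csym x y => yx.
have xy1 : C x y <> C v a by case: (two' x x1 x2 y); congruence.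
have xy2 : C x y <> C v b by case: (two' y y1 y2 x); congruence.
have [u [w [uw [? [? [? _]]]]]] := five_colors (C v a) (C v b) (C x y) (C x y).
have := Csym x v; have := Csym y v => yvE xvE.
have uv : u <> v by move=> ?; subst u; case: (two' v a b w); congruence.
have ux : u <> x by move=> ?; subst u; case: (two' x v y w); congruence.
have uy : u <> y by move=> ?; subst u; case: (two' y v x w); congruence.
have := Csym u v; have := Csym u x; have := Csym u y => uyE uxE uvE.
case: (two u v x w); try congruence; case: (two u v y w); try congruence;
case: (two u x y w); try congruence;
case: (two' v a b u); try congruence; case: (two' x v y u); try congruence;
case: (two' y v x u); try congruence.
all: intuition try congruence.
Qed.

Theorem no_rainbow_path5_structure (d0 : K) :
  (exists v, monochromatic_off v) \/ exists d, dominant d.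
Proof.
have [three|none] := boolP [exists v, exists a, exists b, exists c,
    [&& a != v, b != v, c != v, uniq [:: C v a; C v b; C v c] & true]].
  have /existsP[v /existsP[a /existsP[b /existsP[c]]]] := three.
  rewrite /= !inE negb_or !andbT -!andbA.
  case/and5P=> /eqP av /eqP bv /eqP cv /eqP ab /andP[/eqP ac /eqP bc].
  left; exists v; apply: three_colors_monochromatic_off => p q.
  (* Of three different colors, at least one is neither [p] nor [q]. *)
  have [ap|/eqP ap] := eqVneq (C v a) p; have [aq|/eqP aq] := eqVneq (C v a) q;
  have [bp|/eqP bp] := eqVneq (C v b) p; have [bq|/eqP bq] := eqVneq (C v b) q;
  (try by exists a; split; [|split]; congruence);
  (try by exists b; split; [|split]; congruence);
  by exists c; split; [|split]; congruence.
right; apply: (two_colors_dominant d0) => v a b c /eqP av /eqP bv /eqP cv.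
move/existsPn: none => /(_ v)/existsPn/(_ a)/existsPn/(_ b)/existsPn/(_ c).
rewrite av bv cv /= !inE negb_or !andbT.
by case: (C v a =P C v b); case: (C v a =P C v c); case: (C v b =P C v c) => //=; auto.
Qed.

End NoRainbowPath.

(** * Copies of paths and complete graphs in terms of colors of vertex pairs *)

Lemma image_edgesP (G A : sgraph) (f : G -> A) e :
  reflect (exists x y, adj G x y /\ e = [set f x; f y]) (e \in image_edges f).
Proof.
apply: (iffP imsetP) => [[e']|[x [y [xy ->]]]].
  rewrite inE => /existsP[x /existsP[y /andP[xy /eqP ->]]] ->.
  by exists x, y; rewrite imsetU !imset_set1.
exists [set x; y]; last by rewrite imsetU !imset_set1.
by rewrite inE; apply/existsP; exists x; apply/existsP; exists y; rewrite xy /=.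
Qed.

Lemma exists_notin (T : finType) (s : seq T) : size s < #|T| -> exists x, x \notin s.
Proof.
move=> lt_s; have /subsetPn[x _ xs] : ~~ (T \subset s); last by exists x.
apply: contraL lt_s => /subset_leq_card le_T; rewrite -leqNgt.
exact: leq_trans le_T (card_size s).
Qed.

Section Coloring.

Variables (n k : nat) (c : coloring (complete_graph n) k).

Definition pair_color (x y : 'I_n) : 'I_k := c [set x; y].

Lemma pair_colorC x y : pair_color x y = pair_color y x.
Proof. by rewrite /pair_color setUC. Qed.

Lemma monochromatic_complete_copyP t :
  has_monochromatic_copy (complete_graph t) c <->
  exists (g : 'I_t -> 'I_n) i, injective g /\
    forall x y, x <> y -> pair_color (g x) (g y) = i.
Proof.
split=> [[f [[f_inj _] [i fi]]]|[g [i [g_inj gi]]]].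
  exists f, i; split=> // x y /eqP xy; apply: fi; apply/image_edgesP.
  by exists x, y.
exists g; split; first by split=> // x y; rewrite /= /complete_rel (inj_eq g_inj).
by exists i => e /image_edgesP[x [y [/eqP xy ->]]]; apply: gi.
Qed.

Lemma monochromatic_set_copy t (S : {set 'I_n}) i : t <= #|S| ->
  {in S &, forall x y, x <> y -> pair_color x y = i} ->
  has_monochromatic_copy (complete_graph t) c.
Proof.
move=> tS Si; apply/monochromatic_complete_copyP.
pose g (x : 'I_t) : 'I_n := enum_val (widen_ord tS x).
have g_inj : injective g by move=> x y /enum_val_inj /(congr1 val) /= /val_inj.
exists g, i; split=> // x y xy; apply: Si; rewrite ?enum_valP //.
by move/g_inj.
Qed.

Lemma path_edgesP (f : path_graph 5 -> complete_graph n) e :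
  e \in image_edges f -> exists2 i, i < 4 & e = [set f (inord i); f (inord i.+1)].
Proof.
case/image_edgesP=> x [y [/orP[/eqP xy|/eqP xy] ->]].
  exists x; first by rewrite -ltnS xy.
  by rewrite xy !inord_val.
exists y; first by rewrite -ltnS xy.
by rewrite xy !inord_val setUC.
Qed.

Lemma rainbow_copy_or_no_rainbow_path5 :
  has_rainbow_copy (path_graph 5) c \/ no_rainbow_path5 pair_color.
Proof.
have [/existsP[a /existsP[b /existsP[d /existsP[e /existsP[g /andP[]]]]]]|none] :=
  boolP [exists a, exists b, exists d, exists e, exists g,
    uniq [:: a; b; d; e; g] && uniq [:: pair_color a b; pair_color b d;
                                        pair_color d e; pair_color e g]]; last first.
  right=> a b d e g [[? [? [? ?]]] [[? [? ?]] [[? ?] ?]]].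
  move/existsPn: none => /(_ a)/existsPn/(_ b)/existsPn/(_ d)/existsPn/(_ e).
  move=> /existsPn/(_ g); rewrite negb_and => /orP[/negP[]|].
    by rewrite /= !inE !negb_or !andbT; do ![apply/andP; split]; apply/eqP.
  rewrite /= !inE !andbT !negb_and !negbK -!orbA.
  by case/or4P=> [/eqP|/eqP|/eqP|/or3P[]/eqP]; tauto.
set s := [:: a; b; d; e; g] => s_uniq.
rewrite /= !inE !negb_or !andbT -!andbA => /and5P[/eqP n1 /eqP n2 /eqP n3 /eqP n4].
case/andP=> /eqP n5 /eqP n6; left.
pose f (i : path_graph 5) : complete_graph n := nth a s i.
have fE i : i < 5 -> f (inord i) = nth a s i by move=> ?; rewrite /f inordK.
have f_inj : injective f.
  by move=> i j /eqP; rewrite /f nth_uniq // => /eqP/val_inj.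
exists f; split.
  split=> // x y xy; rewrite /= /complete_rel (inj_eq f_inj).
  by apply: contraTneq xy => ->; rewrite adj_irr.
move=> e1 e2 /path_edgesP[i i4 ->] /path_edgesP[j j4 ->].
rewrite !fE //; try exact: ltnW.
by move: i i4 j j4 => [|[|[|[|//]]]] _ [|[|[|[|//]]]] _ //= ?;
  exfalso; unfold pair_color in *; congruence.
Qed.

Lemma rainbow_copy_path5 : has_rainbow_copy (path_graph 5) c ->
  exists p : nat -> 'I_n, forall i j, i < j < 4 ->
    pair_color (p i) (p i.+1) <> pair_color (p j) (p j.+1).
Proof.
case=> f [[f_inj _] f_rainbow]; exists (fun i => f (inord i)) => i j /andP[ij j4].
have edge_in l : l < 4 -> [set f (inord l); f (inord l.+1)] \in image_edges f.
  move=> l4; apply/image_edgesP; exists (inord l), (inord l.+1); split=> //.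
  by apply/orP; left; rewrite !inordK // ltnW.
move=> /f_rainbow eq_ij.
(* Equal colors would make the two edges equal, but [f (inord i)] is no end of the later edge
   because [i < j]. *)
have /setP/(_ (f (inord i))) := eq_ij (edge_in i (ltn_trans ij j4)) (edge_in j j4).
rewrite !inE eqxx /= !(inj_eq f_inj) -!val_eqE /= !inordK; try lia.
Qed.

Lemma exact_pair_color i : exact_coloring c -> exists x y, x <> y /\ pair_color x y = i.
Proof.
move=> /(_ i)[e]; rewrite inE => /existsP[x /existsP[y /andP[/eqP xy /eqP ->]]] <-.
by exists x, y.
Qed.

(** * Upper bound: monochromatic complete graphs in both structural cases *)

Lemma monochromatic_off_copy v : k < n -> monochromatic_off pair_color v ->
  has_monochromatic_copy (complete_graph k) c.
Proof.
move=> kn [i vi]; apply: (@monochromatic_set_copy k [set~ v] i).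
  by rewrite cardsC1 card_ord; lia.
by move=> x y; rewrite !inE => /eqP xv /eqP yv; apply: vi.
Qed.

Lemma dominant_vertex_color d : dominant pair_color d ->
  exists f : 'I_n -> 'I_k, forall x y, x <> y ->
    pair_color x y = d \/ (f x = pair_color x y /\ f y = pair_color x y).
Proof.
move=> dom.
(* The default makes [d] the label of exactly those vertices that see no other color. *)
pose f x := if [pick y | (y != x) && (pair_color x y != d)] is Some y
  then pair_color x y else d.
have fE x y : y <> x -> pair_color x y <> d -> f x = pair_color x y.
  move=> yx xyd; rewrite /f; case: pickP => [z /andP[/eqP zx /eqP xzd]|/(_ y)].
    by case: (dom x y z yx zx) => [|[]].
  by move/eqP: yx => -> /eqP.
exists f => x y xy; have [|/eqP xyd] := eqVneq (pair_color x y) d; [by left|right].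
split; first by apply: fE => //; apply: nesym.
by rewrite pair_colorC; apply: fE; rewrite 1?pair_colorC.
Qed.

Lemma dominant_copy d : k.-1 ^ 2 < n -> exact_coloring c -> dominant pair_color d ->
  has_monochromatic_copy (complete_graph k) c.
Proof.
move=> nk exact /dominant_vertex_color[f fP].
have surj i : i <> d -> exists x, f x = i.
  move=> id; have [x [y [xy xyi]]] := exact_pair_color i exact.
  by exists x; case: (fP x y xy) => [|[]]; congruence.
(* A vertex labeled [d] makes every color a label, so one vertex can be chosen for each of the [k]
   colors. *)
have [/existsP[u /eqP ud]|/existsPn nd] := boolP [exists u, f u == d].
  have /fin_all_exists[g gK] i : exists x, f x = i.
    by have [->|/eqP /surj //] := eqVneq i d; exists u.
  apply/monochromatic_complete_copyP; exists g, d; split; first exact: can_inj gK.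
  move=> x y xy; case: (fP (g x) (g y)) => [/(congr1 f)|//|[]]; rewrite !gK; congruence.
(* Pigeonhole: [d] is not a label, so more than [k.-1 ^ 2] vertices share [k.-1] labels. *)
have [j kj] : exists j, k <= #|[set x | f x == j]|.
  apply/existsP; apply: contraLR nk => /existsPn small; rewrite -leqNgt.
  have <- : \sum_(j < k) #|[set x | f x == j]| = n.
    rewrite -[RHS]card_ord -sum1_card (partition_big f xpredT) //=.
    by apply: eq_bigr => j _; rewrite -sum1_card; apply: eq_bigl => x; rewrite inE.
  rewrite (bigD1 d) //= eq_card0 => [|x]; last by rewrite !inE (negbTE (nd x)).
  rewrite add0n; apply: (@leq_trans (\sum_(j < k | j != d) k.-1)).
    apply: leq_sum => j _; rewrite -ltnS (ltn_predK (ltn_ord j)) ltnNge.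
    exact: small.
  by rewrite sum_nat_const cardC1 card_ord -mulnn.
have [/existsP[x /existsP[y /and4P[/eqP xj /eqP yj /eqP xy /eqP xyj]]]|none] :=
  boolP [exists x, exists y, [&& f x == j, f y == j, x != y & pair_color x y != j]];
  last first.
  apply: (@monochromatic_set_copy k _ j kj) => x y; rewrite !inE => xj yj /eqP xy.
  move/existsPn: none => /(_ x)/existsPn/(_ y).
  by rewrite xj yj xy /= => /negPn/eqP.
have jd : j <> d by move=> jd; move: (nd x); rewrite xj jd eqxx.
have xyd : pair_color x y = d by case: (fP x y xy) => [|[]]; congruence.
(* Class [j] contributes both ends of the edge [x y]: index [j] takes [x], and index [d], which
   labels no vertex, takes [y]. *)
have /fin_all_exists[g gP] i : exists z,
    [/\ i = d -> z = y, i = j -> z = x & i <> d -> f z = i].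
  have [->|/eqP id] := eqVneq i d; first by exists y; split; congruence.
  have [->|/eqP ij] := eqVneq i j; first by exists x; split; congruence.
  by have [z zi] := surj i id; exists z; split.
have g_neq i l : i <> l -> i <> d -> g i <> g l /\ pair_color (g i) (g l) = d.
  move=> il id; have [_ gj gi] := gP i; have [gld _ gl] := gP l.
  have [ld|/eqP /gl {}gl] := eqVneq l d; last first.
    have gil : g i <> g l by move=> /(congr1 f); rewrite gi // gl.
    by split=> //; case: (fP _ _ gil) => [|[]] //; rewrite gi // gl; congruence.
  have [ij|/eqP ij] := eqVneq i j; first by rewrite gj // gld.
  have gil : g i <> g l by move=> /(congr1 f); rewrite gi // gld // yj; congruence.
  split=> //; case: (fP _ _ gil) => [|[]] //; rewrite gi // gld // yj; congruence.
apply/monochromatic_complete_copyP; exists g, d.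
have g_all i l : i <> l -> g i <> g l /\ pair_color (g i) (g l) = d.
  move=> il; have [id|/eqP id] := eqVneq i d; last exact: g_neq.
  by have [||? ?] := g_neq l i; [congruence..|rewrite pair_colorC; split; auto].
split=> [i l gil|i l /g_all[] //].
by have [//|/eqP /g_all[]] := eqVneq i l.
Qed.

Lemma path5_complete_copy : 5 <= k -> k.-1 ^ 2 < n -> exact_coloring c ->
  has_rainbow_copy (path_graph 5) c \/ has_monochromatic_copy (complete_graph k) c.
Proof.
move=> k5 nk exact.
have [|noP5] := rainbow_copy_or_no_rainbow_path5; [by left|right].
have kn : k < n by apply: leq_ltn_trans nk; rewrite -mulnn; nia.
have vertices u v w x : exists y : 'I_n, y <> u /\ y <> v /\ y <> w /\ y <> x.
  have [|y] := @exists_notin 'I_n [:: u; v; w; x]; first by rewrite card_ord /=; lia.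
  by rewrite !inE !negb_or => /and4P[/eqP ? /eqP ? /eqP ? /eqP ?]; exists y.
have colors p q r s : exists u v, u <> v /\ pair_color u v <> p /\
    pair_color u v <> q /\ pair_color u v <> r /\ pair_color u v <> s.
  have [|i] := @exists_notin 'I_k [:: p; q; r; s]; first by rewrite card_ord.
  rewrite !inE !negb_or => /and4P[/eqP ? /eqP ? /eqP ? /eqP ?].
  by have [u [v [uv uvi]]] := exact_pair_color i exact; exists u, v; rewrite uvi.
have [[v]|[d]] := no_rainbow_path5_structure pair_colorC noP5 vertices colors
  (Ordinal (leq_trans (isT : 0 < 5) k5)).
  exact: monochromatic_off_copy.
exact: dominant_copy.
Qed.

End Coloring.

(** * Lower bound: the block coloring on [m ^ 2] vertices *)

Section BlockColoring.

Variable m : nat.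

Lemma block_proof (x : 'I_(m ^ 2)) : x %/ m < m.
Proof. by case: x => x /=; case: m => [|m'] xm; rewrite ?ltn_divLR ?mulnn. Qed.

Definition block (x : 'I_(m ^ 2)) : 'I_m := Ordinal (block_proof x).

(** Blocks are disjoint, so at most one [i] fits an edge and [pick] is unambiguous; [ord0] is
    reserved for edges between blocks. *)
Definition block_coloring : coloring (complete_graph (m ^ 2)) m.+1 :=
  fun e => if [pick i | e \subset [set x | block x == i]] is Some i
    then lift ord0 i else ord0.

Lemma block_coloringE x y : pair_color block_coloring x y =
  if block x == block y then lift ord0 (block x) else ord0.
Proof.
rewrite /pair_color /block_coloring; case: pickP => [i|/(_ (block x))].
  by rewrite subUset !sub1set !inE => /andP[/eqP -> /eqP ->]; rewrite eqxx.
by rewrite subUset !sub1set !inE eqxx eq_sym /= => ->.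
Qed.

Lemma block_mem (i j : 'I_m) : exists2 x, block x = i & x %% m = j.
Proof.
have m_gt0 := leq_ltn_trans (leq0n _) (ltn_ord i).
have ijm : i * m + j < m ^ 2 by rewrite -mulnn; have := ltn_ord i; have := ltn_ord j; nia.
exists (Ordinal ijm); last by rewrite /= modnMDl modn_small.
by apply: val_inj; rewrite /= divnMDl // divn_small // addn0.
Qed.

(** A block color needs two vertices in its block and [ord0] needs two blocks; [1 < m] gives
    both. *)
Lemma block_coloring_exact : 1 < m -> exact_coloring block_coloring.
Proof.
move=> m_gt1 i.
suff [x [y [xy <-]]] : exists x y, x <> y /\ pair_color block_coloring x y = i.
  exists [set x; y] => //; rewrite inE; apply/existsP; exists x; apply/existsP; exists y.
  by rewrite eqxx andbT; apply/eqP.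
pose o0 : 'I_m := Ordinal (ltnW m_gt1); pose o1 : 'I_m := Ordinal m_gt1.
case: (unliftP ord0 i) => [j|] ->.
  have [x xj x0] := block_mem j o0; have [y yj y1] := block_mem j o1.
  exists x, y; split; last by rewrite block_coloringE xj yj eqxx.
  by move=> xy; move: x0; rewrite xy y1.
have [x x0 _] := block_mem o0 o0; have [y y1 _] := block_mem o1 o0.
exists x, y; rewrite block_coloringE x0 y1 /=; split=> //.
by move=> xy; move: x0; rewrite xy y1.
Qed.

(** Two consecutive edges inside blocks lie in the same block and repeat its color, so on a rainbow
    path one of them has color [ord0]. Four edges split into two such pairs, and [ord0] repeats. *)
Lemma block_coloring_no_rainbow : ~ has_rainbow_copy (path_graph 5) block_coloring.
Proof.
case/rainbow_copy_path5=> p p_inj.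
have step i : i.+1 < 4 -> pair_color block_coloring (p i) (p i.+1) = ord0 \/
    pair_color block_coloring (p i.+1) (p i.+2) = ord0.
  move=> i4; have := p_inj i i.+1; rewrite !block_coloringE ltnSn i4.
  case: eqP => [->|]; last by left.
  by case: eqP => [->|] => [/(_ isT)|]; auto.
have := p_inj 0 2 isT; have := p_inj 0 3 isT.
have := p_inj 1 2 isT; have := p_inj 1 3 isT.
by case: (step 0 isT) => ->; case: (step 2 isT) => ->.
Qed.

(** A clique of color [ord0] has at most one vertex per block. A clique of a block color stays
    inside one block, where remainders modulo [m] separate vertices. Both inject into [m]
    elements. *)
Lemma block_coloring_no_monochromatic :
  ~ has_monochromatic_copy (complete_graph m.+1) block_coloring.
Proof.
case/monochromatic_complete_copyP=> g [i [g_inj gi]].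
suff [h h_inj] : exists h : 'I_m.+1 -> 'I_m, injective h.
  by have := leq_card h h_inj; rewrite !card_ord ltnn.
case: (unliftP ord0 i) gi => [j|] -> gi; last first.
  exists (block \o g) => x y /= gxy; have [//|/eqP /gi] := eqVneq x y.
  by rewrite block_coloringE gxy eqxx.
have m_gt0 := leq_ltn_trans (leq0n _) (ltn_ord j).
exists (fun x => Ordinal (ltn_pmod (g x) m_gt0)) => x y /(congr1 val) /= g_mod.
have [//|/eqP /gi] := eqVneq x y; rewrite block_coloringE; case: eqP => // g_block _.
apply/g_inj/val_inj; rewrite /= (divn_eq (g x) m) (divn_eq (g y) m) g_mod.
by have /= -> := congr1 val g_block.
Qed.

End BlockColoring.

Theorem theorem2p4 (k t : nat) (hk : 5 <= k) (hkt : k = t) :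
  is_gallai_ramsey k (path_graph 5) (complete_graph t) ((t - 1) ^ 2 + 1).
Proof.
subst t; rewrite subn1 addn1; split.
  split=> [|n nk c]; last exact: path5_complete_copy.
  by rewrite binS bin1 -mulnn; nia.
(* A smaller bound would apply to the block coloring on [k.-1 ^ 2] vertices. *)
move=> M [kM bound]; rewrite ltnNge; apply/negP => Mk.
case: k hk bound Mk {kM} => // m m5 bound Mk.
have [||] := bound _ Mk (@block_coloring m).
- by apply: block_coloring_exact; lia.
- exact: block_coloring_no_rainbow.
- exact: block_coloring_no_monochromatic.
Qed.
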